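(* Let $n\ge2$. If $C\subset\mathbb{S}^{n-1}$ is an antipodal spherical $3$-design, then $$\frac{1}{\sqrt n}\le\rho(C)\le\frac1n\sqrt{\frac{|C|}{2}}.$$
   Context: A finite set $C\subset\mathbb{S}^{n-1}\subset\mathbb{R}^n$ is a spherical $\tau$-design if for every polynomial $f(x_1,\dots,x_n)$ of degree at most $\tau$ the average of $f$ over $C$ equals the average of $f$ over $\mathbb{S}^{n-1}$ with respect to the (rotation-invariant) Lebesgue measure. It is antipodal if $C=-C$. $\rho(C):=\min_{y\in\mathbb{S}^{n-1}}\max_{x\in C}\langle x,y\rangle$ (equivalently $\rho(C)=1-r(C)^2/2$, where $r(C)=\max_{y\in\mathbb{S}^{n-1}}\min_{x\in C}d(x,y)$ is the covering radius of $C$ in Euclidean distance). *)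

(* Defs.v *)
From HB Require Import structures.
From mathcomp Require Import all_boot all_order all_algebra finmap.
From mathcomp Require Import all_classical all_reals all_analysis.
From mathcomp Require Import measurable_realfun.
From mathcomp Require mpoly.
(* The notations of mpoly clash with those of MathComp-Analysis. *)
Import (canonicals, coercions) mpoly.

Set Implicit Arguments.
Unset Strict Implicit.
Unset Printing Implicit Defensive.

Import Order.TTheory GRing.Theory Num.Theory.
Import numFieldNormedType.Exports.

Local Open Scope classical_set_scope.
Local Open Scope ring_scope.

Definition measure_matrix_display : measure_display -> measure_display.
Proof. exact. Qed.

(* The product sigma-algebra on matrices, generated by the entries.  On
   'rV[R]_n with R : realType it is the Borel sigma-algebra of R^n. *)
Section measurable_matrix.
Context {d} {T : sigmaRingType d} (m n : nat).

Definition mx_preimages : set (set 'M[T]_(m, n)) :=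
  \bigcup_(ij in [set: 'I_m * 'I_n])
    preimage_set_system setT (fun M : 'M[T]_(m, n) => M ij.1 ij.2) measurable.

Definition mx_measurable : set (set 'M[T]_(m, n)) := <<s mx_preimages >>.

Let mx_measurable0 : mx_measurable set0.
Proof. exact: sigma_algebra0. Qed.

Let mx_measurableC A : mx_measurable A -> mx_measurable (~` A).
Proof. exact: sigma_algebraC. Qed.

Let mx_measurable_bigcup (F : _^nat) : (forall i, mx_measurable (F i)) ->
  mx_measurable (\bigcup_i (F i)).
Proof. exact: sigma_algebra_bigcup. Qed.

HB.instance Definition _ := @isMeasurable.Build (measure_matrix_display d)
  'M[T]_(m, n) mx_measurable mx_measurable0 mx_measurableC mx_measurable_bigcup.

End measurable_matrix.

Section measurable_fun_matrix.
Context {d} {T : measurableType d} (m n : nat).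

Lemma measurable_coord (i : 'I_m) (j : 'I_n) :
  measurable_fun [set: 'M[T]_(m, n)] (fun M : 'M[T]_(m, n) => M i j).
Proof.
move=> _ Y mY; rewrite setTI; apply: sub_sigma_algebra.
by exists (i, j) => //; exists Y => //; rewrite setTI.
Qed.

Lemma measurable_fun_mxP {d'} {U : measurableType d'} (f : U -> 'M[T]_(m, n)) :
  (forall i j, measurable_fun [set: U] (fun x => f x i j)) ->
  measurable_fun [set: U] f.
Proof.
move=> mf; apply: (@measurability _ _ _ _ _ _ (@mx_preimages _ T m n)) => //.
move=> _ [_ [[i j] _ [Y mY <-]] <-]; rewrite !setTI.
by have := mf i j measurableT _ mY; rewrite setTI.
Qed.

End measurable_fun_matrix.

Section euclidean_space.
Context {R : realType} {n : nat}.
Implicit Types x y : 'rV[R]_n.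

Definition dotr x y : R := \sum_(i < n) x 0 i * y 0 i.

(* The canonical norm `|x| of 'rV[R]_n is the sup norm. *)
Definition enorm x : R := Num.sqrt (dotr x x).

Definition sphere : set 'rV[R]_n := [set x | enorm x = 1].

Definition punctured_ball : set 'rV[R]_n := [set x | 0 < enorm x <= 1].

Definition radial_proj x : 'rV[R]_n := (enorm x)^-1 *: x.

Lemma measurable_enorm : measurable_fun setT enorm.
Proof.
apply: (@measurableT_comp _ _ _ _ _ _ (@Num.sqrt R)).
  by apply: continuous_measurable_fun; exact: sqrt_continuous.
by apply: measurable_sum => i; apply: measurable_funM; exact: measurable_coord.
Qed.

Lemma measurable_sphere : measurable sphere.
Proof.
have := measurable_enorm measurableT (measurable_set1 (1 : R)).
by rewrite setTI.
Qed.

Lemma measurable_punctured_ball : measurable punctured_ball.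
Proof.
have mI : measurable (`]0, 1]%classic : set R) by exact: measurable_itv.
have := measurable_enorm measurableT mI.
by rewrite setTI; congr measurable; apply/seteqP; split => x /=; rewrite in_itv.
Qed.

Lemma measurable_radial_proj : measurable_fun setT radial_proj.
Proof.
apply: measurable_fun_mxP => i j.
rewrite (_ : (fun _ => _) = (fun x => enorm x `^ (-1) * x i j)); last first.
  by apply/funext => x; rewrite mxE powR_inv1// sqrtr_ge0.
apply: measurable_funM; last exact: measurable_coord.
exact: (measurableT_comp (measurable_powR (-1)) measurable_enorm).
Qed.

End euclidean_space.
Arguments sphere {R} n.
Arguments punctured_ball {R} n.

Section row_cons.
Context {R : realType} (n : nat).

Definition row_cons (p : measurableTypeR R * 'rV[R]_n) : 'rV[R]_n.+1 :=
  row_mx p.1%:M p.2.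

Lemma row_cons0 p i : row_cons p i ord0 = p.1.
Proof.
rewrite /row_cons mxE; case: splitP => [k _|k]; first by rewrite mxE !ord1 eqxx.
by move=> /eqP; rewrite eq_sym addn_eq0.
Qed.

Lemma row_consS p i k : row_cons p i (lift ord0 k) = p.2 i k.
Proof.
rewrite /row_cons mxE; case: splitP => [l|l /=].
  by rewrite ord1 /= /bump.
by rewrite /bump /= => -[/val_inj ->].
Qed.

Lemma measurable_row_cons : measurable_fun setT row_cons.
Proof.
apply: measurable_fun_mxP => i j.
case: (unliftP ord0 j) => [k ->|->].
  under eq_fun do rewrite row_consS.
  exact: (measurableT_comp (measurable_coord i k) measurable_snd).
by under eq_fun do rewrite row_cons0; exact: measurable_fst.
Qed.

End row_cons.

Section row_cons_measure.
Context {R : realType} (n : nat).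
Variable mu : {sigma_finite_measure set 'rV[R]_n -> \bar R}.
Local Open Scope ereal_scope.

Definition row_cons_measure : set 'rV[R]_n.+1 -> \bar R :=
  pushforward (lebesgue_measure \x mu) (@row_cons R n).

Let row_cons_measure0 : row_cons_measure set0 = 0.
Proof. by rewrite /row_cons_measure /pushforward preimage_set0 measure0. Qed.

Let row_cons_measure_ge0 A : 0 <= row_cons_measure A.
Proof. by rewrite /row_cons_measure /pushforward; apply: measure_ge0. Qed.

Let row_cons_measure_sigma_additive : semi_sigma_additive row_cons_measure.
Proof.
move=> F mF tF mUF; rewrite /row_cons_measure /pushforward preimage_bigcup.
have mC A : measurable A -> measurable (@row_cons R n @^-1` A).
  by move=> mA; rewrite -[X in measurable X]setTI; exact: measurable_row_cons.
apply: measure_semi_sigma_additive.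
- by move=> k; exact: mC.
- apply/trivIsetP => /= i j _ _ ij; rewrite -preimage_setI.
  by move/trivIsetP : tF => /(_ _ _ _ _ ij) ->//; rewrite preimage_set0.
- by rewrite -preimage_bigcup; exact: mC.
Qed.

HB.instance Definition _ := isMeasure.Build _ _ _ row_cons_measure
  row_cons_measure0 row_cons_measure_ge0 row_cons_measure_sigma_additive.

Let row_cons_measure_sigma_finite : sigma_finite setT row_cons_measure.
Proof.
pose split_row (x : 'rV[R]_n.+1) : measurableTypeR R * 'rV[R]_n :=
  (x 0%R 0%R, \row_i x 0%R (lift ord0 i)).
have row_consK : cancel (@row_cons R n) split_row.
  move=> [a v]; rewrite /split_row row_cons0; congr pair.
  by apply/rowP => k; rewrite mxE row_consS.
have msplit : measurable_fun setT split_row.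
  apply/measurable_fun_pair => /=; first exact: measurable_coord.
  apply: measurable_fun_mxP => i j.
  rewrite (_ : (fun _ => _) = fun x : 'rV[R]_n.+1 => x 0%R (lift ord0 j)).
    exact: measurable_coord.
  by apply/funext => x; rewrite mxE.
have /sigma_finiteP[F [FT ndF Foo]] := sigma_finiteT (@lebesgue_measure R).
have /sigma_finiteP[G [GT ndG Goo]] := sigma_finiteT mu.
exists (fun k => split_row @^-1` (F k `*` G k)).
  apply/esym; rewrite -subTset => x _.
  have [k _ Fk] : (\bigcup_k F k) (split_row x).1 by rewrite -FT.
  have [l _ Gl] : (\bigcup_k G k) (split_row x).2 by rewrite -GT.
  exists (maxn k l) => //; split.
    by move: Fk; exact/subsetPset/ndF/leq_maxl.
  by move: Gl; exact/subsetPset/ndG/leq_maxr.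
move=> k; have [mF Fk] := Foo k; have [mG Gk] := Goo k; split.
  by rewrite -[X in measurable X]setTI; apply: msplit => //; exact: measurableX.
rewrite /row_cons_measure /pushforward -comp_preimage.
rewrite (_ : split_row \o _ = id); last first.
  by apply/funext => p /=; exact: row_consK.
by rewrite product_measure1E// lte_mul_pinfty// ge0_fin_numE.
Qed.

HB.instance Definition _ := @Measure_isSigmaFinite.Build _ _ _
  row_cons_measure row_cons_measure_sigma_finite.

End row_cons_measure.

(* n-dimensional Lebesgue measure, as the iterated product of the Lebesgue
   measure of the line *)
Fixpoint lebesgue_rV {R : realType} (n : nat) :
    {sigma_finite_measure set 'rV[R]_n -> \bar R} :=
  if n is n'.+1 then row_cons_measure (lebesgue_rV n')
  else dirac (0 : 'rV[R]_0).

Section surface_measure.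
Context {R : realType} (n : nat).
Local Open Scope ereal_scope.

(* The surface measure of S^(n-1), defined by polar coordinates: a part A of
   the sphere has n times the volume of the cone {r u | 0 < r <= 1, u in A}. *)
Definition surface_measure (A : set 'rV[R]_n) : \bar R :=
  n%:R%:E * lebesgue_rV n ((@radial_proj R n) @^-1` A `&` punctured_ball n).

Let surface_measure0 : surface_measure set0 = 0.
Proof. by rewrite /surface_measure preimage_set0 set0I measure0 mule0. Qed.

Let surface_measure_ge0 A : 0 <= surface_measure A.
Proof. by apply: mule_ge0 => //; rewrite lee_fin. Qed.

Let surface_measure_sigma_additive : semi_sigma_additive surface_measure.
Proof.
pose mu : {measure set 'rV[R]_n -> \bar R} :=
  mscale (NngNum (ler0n R n)) (mrestr (lebesgue_rV n) (@measurable_punctured_ball R n)).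
have mP A : measurable A -> measurable (@radial_proj R n @^-1` A).
  by move=> mA; rewrite -[X in measurable X]setTI; exact: measurable_radial_proj.
move=> F mF tF mUF.
have := @measure_semi_sigma_additive _ _ _ mu (fun k => @radial_proj R n @^-1` F k).
rewrite -preimage_bigcup; apply.
- by move=> k; exact: mP.
- apply/trivIsetP => /= i j _ _ ij; rewrite -preimage_setI.
  by move/trivIsetP : tF => /(_ _ _ _ _ ij) ->//; rewrite preimage_set0.
- exact: mP.
Qed.

HB.instance Definition _ := isMeasure.Build _ _ _ surface_measure
  surface_measure0 surface_measure_ge0 surface_measure_sigma_additive.

End surface_measure.
Arguments surface_measure {R} n.

Section spherical_codes.
Context {R : realType} {n : nat}.
Implicit Types (C : {fset 'rV[R]_n}) (tau : nat).

Definition sphere_mean (f : 'rV[R]_n -> R) : R :=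
  (\int[surface_measure n]_(x in sphere n) f x) /
  fine (surface_measure n (sphere n)).

Definition code_mean C (f : 'rV[R]_n -> R) : R :=
  (\sum_(x <- C) f x) / #|` C|%:R.

Definition peval (p : mpoly.mpoly n R) (x : 'rV[R]_n) : R :=
  mpoly.meval (fun i => x 0 i) p.

(* [mpoly.msize p] is 1 + the total degree of [p], and 0 when [p = 0]. *)
Definition spherical_design tau C : Prop :=
  [set` C] `<=` sphere n /\
  forall p : mpoly.mpoly n R, (mpoly.msize p <= tau.+1)%N ->
    code_mean C (peval p) = sphere_mean (peval p).

Definition antipodal C : Prop := C = [fset - x | x in C]%fset.

Definition rho C : R :=
  inf [set sup [set dotr x y | x in [set` C]] | y in sphere n].

End spherical_codes.

(* Main.v *)
(* Coordinate permutations and sign changes preserve the surface measure, so a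
   3-design C has the second moments of the sphere: sum_(x in C) <x,y>^2 =
   (|C|/n) |y|^2. Averaging, and using C = -C, every unit y has <x,y> >= 1/sqrt n
   for some x in C. For the upper bound, let y be a longest point of the polytope
   {y : |<x,y>| <= 1 for x in C}. The constraints active at y span R^n, so at
   least 2n points x of C satisfy <x,y>^2 = 1; hence (|C|/n) |y|^2 >= 2n, and the
   direction of y satisfies max_(x in C) <x, y/|y|> <= 1/|y| <= sqrt(|C|/2)/n. *)
Require Import Defs.
From mathcomp Require Import all_boot all_order all_algebra finmap.
From mathcomp Require Import all_classical all_reals all_analysis.
From mathcomp Require Import perm measurable_realfun lra.
From mathcomp Require mpoly.
Import (canonicals, coercions) mpoly.

Import Order.TTheory GRing.Theory Num.Theory.
Import numFieldNormedType.Exports.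
Local Open Scope classical_set_scope.
Local Open Scope ring_scope.
Set Implicit Arguments.
Unset Strict Implicit.

(** * Boxes in R^n and the uniqueness of Lebesgue measure *)

Section rectangles.
Context {R : realType} (n : nat).
Implicit Types (A : 'I_n -> set (measurableTypeR R)).

Definition rectangle A : set 'rV[R]_n := [set x | forall i, A i (x 0 i)].

Definition rectangles : set (set 'rV[R]_n) :=
  [set rectangle A | A in [set A | forall i, measurable (A i)]].

Lemma measurable_rectangle A :
  (forall i, measurable (A i)) -> measurable (rectangle A).
Proof.
move=> mA.
rewrite (_ : rectangle A =
    \bigcap_(i in [set: 'I_n]) ((fun x : 'rV[R]_n => x 0 i) @^-1` A i)).
  apply: fin_bigcap_measurable => // i _.
  rewrite -[X in measurable X]setTI.
  exact: (@measurable_coord _ (measurableTypeR R) 1 n 0 i measurableT _ (mA i)).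
by apply/seteqP; split=> [x Ax i _|x Ax i]; exact: Ax.
Qed.

(** A coordinate preimage, which generates the left side, is a box whose other sides are the whole
    line; conversely a box is a finite intersection of coordinate preimages. *)
Lemma measurable_rectangles : (@measurable _ 'rV[R]_n) = <<s rectangles >>.
Proof.
apply/seteqP; split.
- apply: smallest_sub; first exact: smallest_sigma_algebra.
  move=> _ [[i j] _ [Y mY <-]]; apply: sub_sigma_algebra.
  exists (fun k => if k == j then Y else setT); first by move=> k; case: ifP.
  rewrite setTI; apply/seteqP; split=> x /=; rewrite /rectangle /=.
    by move/(_ j); rewrite eqxx ord1.
  by move=> Yx k; case: eqP => // ->; move: Yx; rewrite ord1.
- apply: smallest_sub; first exact: sigma_algebra_measurable.
  by move=> _ [A mA <-]; exact: measurable_rectangle.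
Qed.

Lemma setI_closed_rectangles : setI_closed rectangles.
Proof.
move=> _ _ [A mA <-] [B mB <-]; exists (fun i => A i `&` B i).
  by move=> i; exact: measurableI.
apply/seteqP; split=> x.
  by move=> ABx; split=> i; have [] := ABx i.
by move=> [Ax Bx] i; split.
Qed.

End rectangles.

Section lebesgue_rV.
Context {R : realType}.
Local Open Scope ereal_scope.

Lemma lebesgue_rV_rectangle n (A : 'I_n -> set (measurableTypeR R)) :
  (forall i, measurable (A i)) ->
  lebesgue_rV n (rectangle A) = \prod_(i < n) lebesgue_measure (A i).
Proof.
elim: n A => [|n IH] A mA.
  rewrite big_ord0 /= diracE mem_set//.
  by case.
rewrite big_ord_recl -IH//=.
rewrite /row_cons_measure /pushforward.
rewrite -product_measure1E//; last exact: measurable_rectangle.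
congr (_ _); apply/seteqP; split=> -[a v] /=.
  move=> Aav; split=> [|i] /=; first by have := Aav ord0; rewrite row_cons0.
  by have := Aav (lift ord0 i); rewrite row_consS.
move=> [/= Aa Av] i; case: (unliftP ord0 i) => [j ->|->].
  by rewrite row_consS; exact: Av.
by rewrite row_cons0.
Qed.

(** Boxes form a pi-system generating the sigma-algebra, and the cubes [-k, k]^n exhaust the space
    with finite volume, so agreement on boxes suffices. *)
Lemma lebesgue_rV_unique n (m : {measure set 'rV[R]_n -> \bar R}) :
  (forall A, (forall i, measurable (A i)) ->
    m (rectangle A) = \prod_(i < n) lebesgue_measure (A i)) ->
  forall A, measurable A -> lebesgue_rV n A = m A.
Proof.
move=> mE; pose cube k := @rectangle R n (fun=> `[(- k%:R)%R, k%:R%R]%classic).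
apply: (@measure_unique _ R _ (@rectangles R n) cube) => //.
- exact: measurable_rectangles.
- exact: setI_closed_rectangles.
- by move=> k; exists (fun=> `[(- k%:R)%R, k%:R%R]%classic).
- apply/seteqP; split=> // x _.
  exists (\max_(i < n) Num.bound `|x 0%R i|%R) => // i /=.
  rewrite in_itv/= -ler_norml.
  apply: (le_trans (ltW (archi_boundP (normr_ge0 _)))).
  by rewrite ler_nat; exact: leq_bigmax.
- by move=> _ [A mA <-]; rewrite mE //; exact: lebesgue_rV_rectangle.
- move=> k; change (lebesgue_rV n (cube k) < +oo); rewrite lebesgue_rV_rectangle//.
  rewrite ltey_eq; apply/orP; left; elim/big_ind: _ => //.
    by move=> a b; exact: fin_numM.
  by move=> i _; rewrite lebesgue_measure_itv; case: ifP.
Qed.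

End lebesgue_rV.

(** * Invariance of volume, surface measure and spherical means under signed permutations *)

Lemma lebesgue_measure_sign (R : realType) (b : bool) (A : set (measurableTypeR R)) :
  measurable A ->
  let B := ( *%R ((-1) ^+ b)) @^-1` A : set (measurableTypeR R) in
  measurable B /\ lebesgue_measure B = lebesgue_measure A.
Proof.
move=> mA /=; split.
  have mM : measurable_fun setT
      ( *%R ((-1) ^+ b) : measurableTypeR R -> measurableTypeR R).
    exact: measurable_funM.
  by rewrite -[X in measurable X]setTI; exact: mM.
case: b.
  rewrite -[RHS](lebesgue_measureN mA) /pushforward; congr lebesgue_measure.
  by apply/seteqP; split=> t /=; rewrite mulN1r.
by congr lebesgue_measure; apply/seteqP; split=> t /=; rewrite mul1r.
Qed.

Section signed_permutation.
Context {R : realType} {n : nat} (s : 'S_n) (e : 'I_n -> bool).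

(** These are the symmetries of the cube. They send boxes to boxes, so invariance can be read off
    side by side, and they already determine the second moments of the sphere. *)
Definition signed_perm (x : 'rV[R]_n) : 'rV[R]_n :=
  \row_i ((-1) ^+ e i * x 0 (s i)).

Lemma measurable_signed_perm : measurable_fun setT signed_perm.
Proof.
apply: measurable_fun_mxP => i j.
rewrite (_ : (fun _ => _) = fun x : 'rV[R]_n => (-1) ^+ e j * x 0 (s j)).
  by apply: measurable_funM => //; exact: measurable_coord.
by apply/funext => x; rewrite mxE.
Qed.

Lemma enorm_signed_perm x : enorm (signed_perm x) = enorm x.
Proof.
congr Num.sqrt; rewrite /dotr [RHS](reindex_inj (@perm_inj _ s)).
by apply: eq_bigr => i _; rewrite !mxE mulrACA -expr2 sqrr_sign mul1r.
Qed.

Lemma radial_proj_signed_perm x :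
  radial_proj (signed_perm x) = signed_perm (radial_proj x).
Proof.
by apply/rowP => i; rewrite /radial_proj enorm_signed_perm !mxE mulrCA.
Qed.

Lemma lebesgue_rV_signed_perm A :
  measurable A -> lebesgue_rV n (signed_perm @^-1` A) = lebesgue_rV n A.
Proof.
move=> mA; apply/esym.
rewrite -[RHS]/(pushforward (lebesgue_rV n) signed_perm A).
apply: (@lebesgue_rV_unique R n (pushforward (lebesgue_rV n) signed_perm)) => //.
  exact: measurable_signed_perm.
move=> mT B mB.
(* Coordinate [j] of a point lands in position [s^-1 j], so it is constrained by the side of [B] at
   that position, up to sign. *)
pose B' j : set (measurableTypeR R) :=
  ( *%R ((-1) ^+ e (s^-1%g j))) @^-1` B (s^-1%g j).
have mB' j : measurable (B' j).
  by have [] := lebesgue_measure_sign (e (s^-1%g j)) (mB (s^-1%g j)).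
change (lebesgue_rV n (signed_perm @^-1` rectangle B) =
  (\prod_(i < n) lebesgue_measure (B i))%E).
rewrite (_ : _ @^-1` _ = rectangle B'); last first.
  apply/seteqP; split=> x /= Bx i.
    by have := Bx (s^-1%g i); rewrite mxE permKV.
  by have := Bx (s i); rewrite /B' /= mxE permK.
rewrite lebesgue_rV_rectangle// (reindex_inj (@perm_inj _ s)) /=.
by apply: eq_bigr => i _; rewrite /B' permK;
  have [] := lebesgue_measure_sign (e i) (mB i).
Qed.

(** A signed permutation is a linear isometry, hence commutes with radial projection and carries the
    cone over a set to the cone over its image. *)
Lemma surface_measure_signed_perm A :
  measurable A -> surface_measure n (signed_perm @^-1` A) = surface_measure n A.
Proof.
move=> mA; rewrite /surface_measure; congr (_ * _)%E.
rewrite -[RHS]lebesgue_rV_signed_perm; last first.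
  apply: measurableI; last exact: measurable_punctured_ball.
  rewrite -[X in measurable X]setTI; exact: measurable_radial_proj.
congr (_ _); apply/seteqP; split=> x /=.
  by rewrite radial_proj_signed_perm /punctured_ball /= enorm_signed_perm.
by rewrite radial_proj_signed_perm /punctured_ball /= enorm_signed_perm.
Qed.

Lemma sphere_mean_signed_perm (f : 'rV[R]_n -> R) : measurable_fun setT f ->
  sphere_mean (f \o signed_perm) = sphere_mean f.
Proof.
move=> mf; rewrite /sphere_mean; congr (_ / _).
have mT := measurable_signed_perm; have mS := @measurable_sphere R n.
have ST : signed_perm @^-1` sphere n = sphere n.
  by apply/seteqP; split=> x; rewrite /sphere /= enorm_signed_perm.
rewrite /Rintegral; congr fine.
(* The change of variables is done for nonnegative functions, then applied to the positive and
   negative parts of [f]. *)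
have key (g : 'rV[R]_n -> \bar R) : measurable_fun setT g -> (forall x, 0 <= g x)%E ->
    (\int[surface_measure n]_(x in sphere n) g (signed_perm x) =
     \int[surface_measure n]_(x in sphere n) g x)%E.
  move=> mg g0.
  rewrite -[in LHS]ST -(ge0_integral_pushforward mT (surface_measure n) mS)//.
    apply: (@eq_measure_integral _ _ _ _ (surface_measure n)) => A mA _.
    by rewrite -[RHS](surface_measure_signed_perm mA) /=; reflexivity.
  exact: measurable_funTS.
have mfE : measurable_fun setT (EFin \o f) by exact/measurable_EFinP.
rewrite [LHS]integralE [RHS]integralE.
have := key _ (measurable_funepos mfE) (funepos_ge0 _).
have := key _ (measurable_funeneg mfE) (funeneg_ge0 _).
move=> <- <-; congr (_ - _)%E; apply: eq_integral => x _.
  by rewrite !funeposE.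
by rewrite !funenegE.
Qed.

End signed_permutation.

(** * The Euclidean inner product and the total mass of the sphere *)

Section dotr_theory.
Context {R : realType} {n : nat}.
Implicit Types x y z : 'rV[R]_n.

Lemma dotrC x y : dotr x y = dotr y x.
Proof. by apply: eq_bigr => i _; rewrite mulrC. Qed.

Lemma dotrDr x y z : dotr x (y + z) = dotr x y + dotr x z.
Proof. by rewrite -big_split; apply: eq_bigr => i _; rewrite mxE mulrDr. Qed.

Lemma dotrZr a x y : dotr x (a *: y) = a * dotr x y.
Proof. by rewrite mulr_sumr; apply: eq_bigr => i _; rewrite mxE mulrCA. Qed.

Lemma dotrNl x y : dotr (- x) y = - dotr x y.
Proof. by rewrite -sumrN; apply: eq_bigr => i _; rewrite mxE mulNr. Qed.

Lemma dotr_ge0 x : 0 <= dotr x x.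
Proof. by apply: sumr_ge0 => i _; rewrite -expr2 sqr_ge0. Qed.

Lemma sqr_coord_le_dotr x i : x 0 i ^+ 2 <= dotr x x.
Proof.
rewrite /dotr (bigD1 i)//= -expr2 lerDl.
by apply: sumr_ge0 => j _; rewrite -expr2 sqr_ge0.
Qed.

Lemma dotr_eq0 x : dotr x x <= 0 -> x = 0.
Proof.
move=> x0; apply/rowP => i; rewrite mxE; apply/eqP; rewrite -sqrf_eq0.
by rewrite eq_le sqr_ge0 andbT (le_trans (sqr_coord_le_dotr x i)).
Qed.

Lemma sqr_enorm x : enorm x ^+ 2 = dotr x x.
Proof. by rewrite sqr_sqrtr ?dotr_ge0. Qed.

Lemma enormZ a x : 0 <= a -> enorm (a *: x) = a * enorm x.
Proof.
move=> a0; rewrite /enorm dotrZr dotrC dotrZr mulrA -expr2.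
by rewrite sqrtrM ?sqr_ge0// sqrtr_sqr ger0_norm.
Qed.

Lemma enorm_radial_proj x : 0 < enorm x -> enorm (radial_proj x) = 1.
Proof.
by move=> x0; rewrite enormZ ?mulVf ?gt_eqF// invr_ge0 ltW.
Qed.

Lemma continuous_dotr x : continuous (dotr x).
Proof.
apply: (@continuous_big R^o 'I_n +%R 0 xpredT (@add_continuous R^o) _ _
  (fun i y => x 0 i * y 0 i)) => i _ y.
apply: (@continuousM R _ (fun=> x 0 i)); first exact: cst_continuous.
exact: coord_continuous.
Qed.

Lemma continuous_dotr_diag : continuous (fun x : 'rV[R]_n => dotr x x).
Proof.
apply: (@continuous_big R^o 'I_n +%R 0 xpredT (@add_continuous R^o) _ _
  (fun i y => y 0 i * y 0 i)) => i _ y.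
by apply: (@continuousM R); exact: coord_continuous.
Qed.

End dotr_theory.

(** Since [fine] sends infinity to 0, the mass has to be shown finite as well as positive: the
    punctured ball is squeezed between two cubes. *)
Lemma surface_measure_sphere_gt0 {R : realType} n : (0 < n)%N ->
  0 < fine (surface_measure n (sphere n : set 'rV[R]_n)).
Proof.
move=> n0; have n0' : (0 : R) < n%:R by rewrite ltr0n.
have nV0 : (0 : R) < n%:R^-1 by rewrite invr_gt0.
pose cube (a b : R) := @rectangle R n (fun=> `]a, b]%classic).
have cubeE a b : a < b -> lebesgue_rV n (cube a b) = ((b - a) ^+ n)%:E.
  move=> ab; rewrite lebesgue_rV_rectangle//.
  rewrite (eq_bigr (fun=> (b - a)%:E)); last first.
    by move=> i _; rewrite lebesgue_measure_itv/= lte_fin ab.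
  by rewrite prodEFin prodr_const card_ord.
have mcube a b : measurable (cube a b) by exact: measurable_rectangle.
have mpb := @measurable_punctured_ball R n.
(* With 0 < x_i <= 1/n, each square is at most 1/n, and the n squares sum to at most 1. *)
have sub1 : cube 0 n%:R^-1 `<=` punctured_ball n.
  move=> x cx; apply/andP; split.
    rewrite sqrtr_gt0; apply: lt_le_trans (sqr_coord_le_dotr x (Ordinal n0)).
    by rewrite exprn_gt0//; have := cx (Ordinal n0); rewrite /= in_itv => /andP[].
  rewrite -sqrtr1 ler_wsqrtr// (@le_trans _ _ (\sum_(i < n) n%:R^-1))//.
    apply: ler_sum => i _; have := cx i; rewrite /= in_itv => /andP[xi0 xin].
    have x1 : x 0 i <= 1 by rewrite (le_trans xin)// invf_le1// ler1n.
    by rewrite -[leRHS]mulr1 ler_pM// ltW.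
  by rewrite sumr_const card_ord -[_ *+ n]mulr_natr mulVf ?gt_eqF.
(* The intervals are open on the left, so -1 would lose points of the ball; -2 leaves room. *)
have sub2 : punctured_ball n `<=` cube (-2) 1.
  move=> x /andP[_ x1] i /=; rewrite in_itv /=.
  have : `|x 0 i| <= 1.
    rewrite -(@ler_pXn2r _ 2)// ?nnegrE// expr1n real_normK ?num_real//.
    by rewrite (le_trans (sqr_coord_le_dotr x i))// -sqr_enorm expr_le1// sqrtr_ge0.
  by rewrite ler_norml => /andP[h ->]; rewrite andbT (lt_le_trans _ h)// ltrN2 ltr1n.
(* The cone over the whole sphere is the punctured ball. *)
have -> : surface_measure n (sphere n : set 'rV[R]_n) =
    (n%:R%:E * lebesgue_rV n (punctured_ball n))%E.
  congr (_ * _)%E; congr (_ _); apply/seteqP; split=> x.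
    by case.
  move=> xb; split=> //; apply: enorm_radial_proj.
  by case/andP: xb.
have le1 : (lebesgue_rV n (cube 0%R n%:R^-1%R) <= lebesgue_rV n (punctured_ball n))%E.
  by apply: le_measure sub1; rewrite inE.
have le2 : (lebesgue_rV n (punctured_ball n) <= lebesgue_rV n (cube (- 2)%R 1%R))%E.
  by apply: le_measure sub2; rewrite inE.
have lt21 : - 2 < 1 :> R by rewrite (@lt_trans _ _ 0) ?oppr_lt0.
move: le1 le2; rewrite (cubeE _ _ nV0) (cubeE _ _ lt21) subr0 => le1 le2.
apply: fine_gt0; apply/andP; split.
  by rewrite mule_gt0 ?lte_fin// (lt_le_trans _ le1)// lte_fin exprn_gt0.
by rewrite lte_mul_pinfty ?lee_fin// (le_lt_trans le2)// ltry.
Qed.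

(** * Second moments of a spherical 3-design *)

Section design_moments.
Context {R : realType} {n : nat} (C : {fset 'rV[R]_n}).
Hypotheses (n_gt0 : (0 < n)%N) (desC : spherical_design 3 C).

Lemma design_monomial2 (c : R) i j :
  code_mean C (fun x => c * (x 0 i * x 0 j)) =
  sphere_mean (fun x : 'rV[R]_n => c * (x 0 i * x 0 j)).
Proof.
pose p : mpoly.mpoly n R :=
  c *: (mpoly.mpolyX R (mpoly.mnm1 i) * mpoly.mpolyX R (mpoly.mnm1 j)).
have pE : peval p = fun x => c * (x 0 i * x 0 j).
  by apply/funext => x; rewrite /peval mpoly.mevalZ mpoly.mevalM !mpoly.mevalXU.
rewrite -pE; apply: desC.2.
rewrite (leq_trans (mpoly.msizeZ_le _ _))// -mpoly.mpolyXD mpoly.msizeX.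
by rewrite mpoly.mdegD !mpoly.mdeg1.
Qed.

(** The constant polynomial 1 has spherical mean 1, whereas an empty code would give mean 0,
    division by zero being 0. *)
Lemma design_neq0 : (#|` C|%:R : R) != 0.
Proof.
apply/eqP => C0.
have peval1 : peval (1 : mpoly.mpoly n R) = fun=> 1.
  by apply/funext => x; rewrite /peval mpoly.meval1.
have := desC.2 1; rewrite mpoly.msize1 peval1 => /(_ isT).
rewrite /code_mean C0 invr0 mulr0 /sphere_mean Rintegral_cst//; last first.
  exact: measurable_sphere.
rewrite mul1r divff => [/eqP|]; first by rewrite eq_sym oner_eq0.
by rewrite gt_eqF// surface_measure_sphere_gt0.
Qed.

(** Symmetry passes from the sphere to the code: [C] itself need not be invariant, but its quadratic
    means equal spherical means, which are. *)
Lemma design_sum_signed_perm s e (c : R) i j i' j' :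
  (forall x : 'rV[R]_n, signed_perm s e x 0 i * signed_perm s e x 0 j =
                        c * (x 0 i' * x 0 j')) ->
  \sum_(x <- C) x 0 i * x 0 j = c * \sum_(x <- C) x 0 i' * x 0 j'.
Proof.
move=> Ts; apply: (divIf design_neq0).
have := design_monomial2 1 i j; rewrite -(sphere_mean_signed_perm s e); last first.
  by apply: measurable_funM => //; apply: measurable_funM; exact: measurable_coord.
rewrite (_ : _ \o _ = fun x : 'rV[R]_n => c * (x 0 i' * x 0 j')); last first.
  by apply/funext => x /=; rewrite mul1r Ts.
by rewrite -design_monomial2 /code_mean -!mulr_sumr mul1r.
Qed.

Lemma design_coord_sum i j :
  \sum_(x <- C) x 0 i * x 0 j = (#|` C|%:R / n%:R) *+ (i == j).
Proof.
have n0 : (n%:R : R) != 0 by rewrite pnatr_eq0 -lt0n.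
have [<-{j}|ij] := eqVneq i j; last first.
  (* Flipping the sign of coordinate [i] alone shows that the mixed sum equals its own negative. *)
  have := @design_sum_signed_perm 1%g (pred1 i) (-1) i j i j.
  rewrite mulN1r => /(_ _)/eqP; rewrite -subr_eq0 opprK -mulr2n mulrn_eq0/=.
  move=> h; apply/eqP/h => x.
  by rewrite !mxE !perm1 /= eqxx eq_sym (negbTE ij) expr1 expr0 mul1r !mulN1r mulNr.
rewrite mulr1n; apply/esym/(canLR (mulfK n0)).
(* The points have norm 1, so the n diagonal sums add up to the cardinality; transpositions make
   them all equal. *)
have -> : #|` C|%:R = \sum_(k < n) \sum_(x <- C) x 0 k * x 0 k :> R.
  rewrite exchange_big/= -sum1_size natr_sum big_seq [RHS]big_seq.
  apply: eq_bigr => x xC; have : enorm x = 1 by exact: desC.1.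
  by rewrite -/(dotr x x) -sqr_enorm => ->; rewrite expr1n.
rewrite (eq_bigr (fun=> \sum_(x <- C) x 0 i * x 0 i)).
  by rewrite sumr_const card_ord mulr_natr.
move=> k _.
rewrite (@design_sum_signed_perm (tperm k i) (fun=> false) 1 k k i i) ?mul1r// => x.
by rewrite !mxE tpermL expr0 !mul1r.
Qed.

Lemma design_tight_frame y :
  \sum_(x <- C) dotr x y ^+ 2 = #|` C|%:R / n%:R * dotr y y.
Proof.
under eq_bigr do rewrite expr2 /dotr mulr_suml.
rewrite exchange_big/= [RHS]mulr_sumr; apply: eq_bigr => i _.
under eq_bigr do rewrite mulr_sumr.
rewrite exchange_big/= (bigD1 i)//= [X in _ + X]big1 ?addr0.
  under eq_bigr do rewrite mulrACA.
  by rewrite -mulr_suml design_coord_sum eqxx.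
move=> j ji; under eq_bigr do rewrite mulrACA.
by rewrite -mulr_suml design_coord_sum eq_sym (negbTE ji) mul0r.
Qed.

End design_moments.

(** * A vertex of the polar polytope of a tight frame *)

Section tight_frame_vertex.
Context {R : realType} {n : nat} (C : {fset 'rV[R]_n}) (c : R).
Hypotheses (c_gt0 : 0 < c)
  (tight : forall y, \sum_(x <- C) dotr x y ^+ 2 = c * dotr y y).

Let polar : set 'rV[R]_n := [set y | forall x, x \in C -> `|dotr x y| <= 1].

(** The frame identity bounds the polytope: c |y|^2 is a sum of |C| terms, each at most 1. *)
Let compact_polar : compact polar.
Proof.
(* Adding 1 ensures M <= M^2, so y_i^2 <= |C|/c gives |y_i| <= M. *)
pose M := 1 + #|` C|%:R / c.
have M1 : 1 <= M by rewrite lerDl divr_ge0// ltW.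
have box : compact [set v : 'rV[R]_n | forall i, `[- M, M]%classic (v ord0 i)].
  by apply: (@rV_compact _ _ (fun=> `[- M, M]%classic)) => _; exact: segment_compact.
apply: subclosed_compact box _.
  rewrite (_ : polar = \bigcap_(x in [set` C]) [set y | `|dotr x y| <= 1]); last first.
    by apply/seteqP; split=> y Py x; exact: Py.
  apply: closed_bigI => x _.
  apply: (@preimage_closed _ _ (fun y => `|dotr x y|) [set r : R | r <= 1]).
    move=> y _; apply: continuous_comp; first exact: continuous_dotr.
    exact: norm_continuous.
  exact: closed_le.
move=> y Py i /=; rewrite in_itv/= -ler_norml.
have y2 : y 0 i ^+ 2 <= #|` C|%:R / c.
  apply: le_trans (sqr_coord_le_dotr y i) _.
  rewrite ler_pdivlMr// mulrC -tight -sum1_size natr_sum big_seq [leRHS]big_seq.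
  apply: ler_sum => x xC; rewrite -real_normK ?num_real// expr_le1//.
  exact: Py.
rewrite -(@ler_pXn2r _ 2)// ?nnegrE//; last by rewrite (le_trans _ M1).
rewrite real_normK ?num_real// (le_trans y2)// (@le_trans _ _ M)//.
  by rewrite lerDr.
by rewrite expr2 ler_peMl// (le_trans _ M1).
Qed.

(* A point of maximal norm of the polar polytope is a vertex: were z orthogonal
   to all active constraints, one of y + t z, y - t z would be longer. *)
Lemma tight_frame_vertex : exists2 y : 'rV[R]_n,
  forall x, x \in C -> `|dotr x y| <= 1 &
  forall z, (forall x, x \in C -> `|dotr x y| = 1 -> dotr x z = 0) -> z = 0.
Proof.
have polar0 : polar !=set0.
  by exists 0 => x _; rewrite -(scale0r 0) dotrZr mul0r normr0.
have [y /set_mem Py ymax] := compact_EVT_max polar0 compact_polar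
  (continuous_subspaceT (@continuous_dotr_diag R n)).
exists y => // z zP.
(* One step length [t] must respect every constraint. It is built by induction on the list of
   points: active constraints are unaffected by [z], and each inactive one has positive slack. *)
have [t t0 tP] : exists2 t : R, 0 < t & forall x, x \in C ->
    `|dotr x y| + t * `|dotr x z| <= 1.
  suff [t t0 tP] : exists2 t : R, 0 < t & forall x, x \in enum_fset C -> x \in C ->
    `|dotr x y| + t * `|dotr x z| <= 1 by exists t => // x xC; exact: tP.
  elim: (enum_fset C) => [|x s [t t0 tP]]; first by exists 1.
  have [xC|xC] := boolP (x \in C); last first.
    exists t => // x' /[!inE]/predU1P[->|]; first by rewrite (negbTE xC).
    exact: tP.
  have [xy1|xy1] := eqVneq `|dotr x y| 1.
    exists t => // x' /[!inE]/predU1P[-> _|]; last exact: tP.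
    by rewrite zP// normr0 mulr0 addr0 xy1.
  have slack : 0 < 1 - `|dotr x y| by rewrite subr_gt0 lt_neqAle xy1 Py.
  have z1 : 0 < 1 + `|dotr x z| by rewrite ltr_pwDl.
  (* The 1 in the denominator avoids dividing by zero when [x] is orthogonal to [z]. *)
  exists (Num.min t ((1 - `|dotr x y|) / (1 + `|dotr x z|))).
    by rewrite lt_min t0 divr_gt0.
  move=> x' /[!inE]/predU1P[-> _|x's x'C].
    rewrite -lerBrDl.
    rewrite (@le_trans _ _ ((1 - `|dotr x y|) / (1 + `|dotr x z|) * `|dotr x z|))//.
      by rewrite ler_wpM2r// ge_min lexx orbT.
    by rewrite -mulrA ger_pMr// ler_pdivrMl// mulr1 lerDr.
  apply: le_trans (tP _ x's x'C); rewrite lerD2l ler_wpM2r//.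
  by rewrite ge_min lexx.
have inP (u : R) : `|u| = t -> dotr (y + u *: z) (y + u *: z) <= dotr y y.
  move=> ut; apply: ymax; apply/mem_set => x xC.
  rewrite dotrDr dotrZr (le_trans (ler_normD _ _))// normrM ut.
  exact: tP.
have Pp := inP t (gtr0_norm t0).
have Pm := inP (- t) (etrans (normrN t) (gtr0_norm t0)).
(* Adding the inequalities for y + t z and y - t z cancels the cross terms and leaves t^2 |z|^2 <=
   0. *)
apply: dotr_eq0; rewrite -(pmulr_rle0 _ (exprn_gt0 2 t0)).
move: Pp Pm; rewrite !(dotrDr, dotrZr) ![dotr (_ + _) _]dotrC !(dotrDr, dotrZr) (dotrC z y).
lra.
Qed.

End tight_frame_vertex.

(** * Counting the active constraints of an antipodal code *)

Section spanning.
Context {R : realType} {n : nat}.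

(** Fewer than n vectors, taken as the columns of a matrix, leave a nonzero left kernel, that is, a
    nonzero vector orthogonal to all of them. *)
Lemma spanning_size (s : seq 'rV[R]_n) :
  (forall z, (forall x, x \in s -> dotr x z = 0) -> z = 0) -> (n <= size s)%N.
Proof.
move=> span; rewrite leqNgt; apply/negP => sn.
pose A : 'M[R]_(n, size s) := \matrix_(i, j) (nth 0 s j) 0 i.
have : kermx A != 0.
  by rewrite -mxrank_eq0 mxrank_ker subn_eq0 -ltnNge (leq_ltn_trans (rank_leq_col A)).
case/rowV0Pn => z /sub_kermxP zA; case/eqP; apply: span => x xs.
have xj : (index x s < size s)%N by rewrite index_mem.
have := congr1 (fun B : 'rV_(size s) => B 0 (Ordinal xj)) zA.
rewrite !mxE => <-; apply: eq_bigr => i _.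
by rewrite !mxE/= nth_index// mulrC.
Qed.

End spanning.

Section covering.
Context {R : realType} {n : nat} (C : {fset 'rV[R]_n}).
Hypotheses (n_gt0 : (0 < n)%N) (antiC : antipodal C).

Lemma antipodalN x : x \in C -> - x \in C.
Proof. by move=> xC; rewrite antiC; apply/imfsetP; exists x. Qed.

Lemma antipodal_sum (f : 'rV[R]_n -> R) :
  \sum_(x <- C) f (- x) = \sum_(x <- C) f x.
Proof.
rewrite -(big_map -%R xpredT f); apply/perm_big/uniq_perm => //.
  by rewrite (map_inj_uniq oppr_inj) fset_uniq.
  exact: fset_uniq.
move=> x; apply/mapP/idP => [[x' x'C ->]|xC]; first exact: (antipodalN x'C).
by exists (- x); rewrite ?opprK//; exact: (antipodalN xC).
Qed.

(** Up to sign every active point has inner product 1 with [y], so the points with value 1 still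
    span and number at least n; their antipodes, with value -1, give n more. *)
Lemma antipodal_active (y : 'rV[R]_n) :
  (forall x, x \in C -> `|dotr x y| <= 1) ->
  (forall z, (forall x, x \in C -> `|dotr x y| = 1 -> dotr x z = 0) -> z = 0) ->
  n%:R *+ 2 <= \sum_(x <- C) dotr x y ^+ 2.
Proof.
move=> Py vert.
pose a (x : 'rV[R]_n) : R := (dotr x y == 1)%:R.
have nC : (n%:R : R) <= \sum_(x <- C) a x.
  rewrite -natr_sum ler_nat -big_mkcond/= sum1_count -size_filter.
  apply: spanning_size => z zP; apply: vert => x xC.
  have [xy|xy] := leP 0 (dotr x y).
    by rewrite ger0_norm// => xy1; apply: zP; rewrite mem_filter xy1 eqxx.
  rewrite ltr0_norm// -dotrNl => xy1; apply: oppr_inj; rewrite oppr0 -dotrNl.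
  by apply: zP; rewrite mem_filter xy1 eqxx antipodalN.
(* Reindexed by negation, the second copy counts the points with value -1, and the comparison
   becomes termwise. *)
rewrite mulr2n (le_trans (lerD nC nC))// -[X in _ + X]antipodal_sum.
rewrite -big_split/= ler_sum// => x _; rewrite /a dotrNl eqr_oppLR.
have [->|_] := eqVneq (dotr x y) 1; last have [->|_] := eqVneq (dotr x y) (- 1).
- by rewrite expr1n -subr_eq0 opprK -mulr2n pnatr_eq0 addr0.
- by rewrite sqrrN expr1n add0r.
- by rewrite addr0 sqr_ge0.
Qed.

End covering.

(** * The two bounds on the covering parameter *)

Section covering_bounds.
Context {R : realType} {n : nat} (C : {fset 'rV[R]_n}).
Hypotheses (n_gt0 : (0 < n)%N) (antiC : antipodal C) (desC : spherical_design 3 C).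
Implicit Types x y : 'rV[R]_n.

Let card_gt0 : 0 < #|` C|%:R :> R.
Proof. by rewrite lt_neqAle eq_sym ler0n andbT; exact: design_neq0. Qed.

Let n0 : 0 < n%:R :> R.
Proof. by rewrite ltr0n. Qed.

Let C0 : exists x, x \in C.
Proof. by apply/fset0Pn; rewrite -cardfs_gt0 -(ltr_nat R). Qed.

Lemma code_height_ubound y : has_ubound [set dotr x y | x in [set` C]].
Proof.
exists (\sum_(x <- C) `|dotr x y|) => _ [x xC <-].
rewrite (le_trans (ler_norm _))// (big_fsetD1 x)//= lerDl.
exact: sumr_ge0.
Qed.

(** The squares of the inner products average to 1/n over the code, so one of them is at least 1/n;
    if that inner product is negative, the antipode is used. *)
Lemma code_height_ge y : sphere n y ->
  1 / Num.sqrt n%:R <= sup [set dotr x y | x in [set` C]].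
Proof.
move=> y1; have yy : dotr y y = 1 by rewrite -sqr_enorm y1 expr1n.
have [x xC xy] : exists2 x, x \in C & 1 / Num.sqrt n%:R <= `|dotr x y|.
  apply: contrapT => /forall2NP small.
  have : \sum_(x <- C) dotr x y ^+ 2 < \sum_(x <- C) (n%:R^-1 : R).
    (* Splitting off one point keeps the inequality between the sums strict. *)
    have [x0 x0C] := C0.
    have lt x : x \in C -> dotr x y ^+ 2 < n%:R^-1.
      move=> xC; have [//|/negP] := small x; rewrite -ltNge => xy.
      rewrite -real_normK ?num_real// -[ltRHS]sqr_sqrtr ?invr_ge0 ?ltW//.
      by rewrite ltr_pXn2r// ?nnegrE ?sqrtr_ge0// sqrtrV ?ltW// -div1r.
    rewrite (big_fsetD1 x0)//= [ltRHS](big_fsetD1 x0)//= ltr_leD ?lt//.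
    rewrite big_seq [leRHS]big_seq; apply: ler_sum => x; rewrite !inE => /andP[_ xC].
    exact/ltW/lt.
  rewrite design_tight_frame// yy mulr1 big_const_seq count_predT iter_addr_0.
  by rewrite -[ltRHS]mulr_natl ltxx.
have [xy0|xy0] := leP 0 (dotr x y).
  rewrite (le_trans xy)// ger0_norm//; apply: ub_le_sup; first exact: code_height_ubound.
  by exists x.
rewrite (le_trans xy)// ltr0_norm// -dotrNl; apply: ub_le_sup; first exact: code_height_ubound.
by exists (- x) => //; exact: antipodalN.
Qed.

Lemma code_height_le : exists2 y, sphere n y &
  sup [set dotr x y | x in [set` C]] <= 1 / n%:R * Num.sqrt (#|` C|%:R / 2).
Proof.
have c0 : 0 < #|` C|%:R / n%:R :> R by rewrite divr_gt0.
have [y Py vert] := tight_frame_vertex c0 (design_tight_frame n_gt0 desC).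
have := antipodal_active antiC Py vert; rewrite design_tight_frame// => yge.
(* This rearranges 2n <= (|C|/n) |y|^2; its left side is the inverse square of the claimed bound. *)
have y2 : n%:R ^+ 2 / (#|` C|%:R / 2) <= dotr y y.
  rewrite ler_pdivrMr ?divr_gt0//; move: yge.
  rewrite mulrAC ler_pdivlMr// expr2; lra.
have bound_gt0 : 0 < 1 / n%:R * Num.sqrt (#|` C|%:R / 2) :> R.
  by rewrite mulr_gt0 ?divr_gt0// sqrtr_gt0 divr_gt0.
have yV : (1 / n%:R * Num.sqrt (#|` C|%:R / 2))^-1 <= enorm y.
  rewrite -(@ler_pXn2r _ 2)// ?nnegrE ?invr_ge0 ?sqrtr_ge0 ?(ltW bound_gt0)//.
  rewrite sqr_enorm (le_trans _ y2)// exprVn exprMn sqr_sqrtr ?divr_ge0//.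
  by rewrite invfM div1r exprVn invrK.
have y0 : 0 < enorm y by rewrite (lt_le_trans _ yV)// invr_gt0.
exists (radial_proj y); first exact: enorm_radial_proj.
apply: ge_sup; first by have [x xC] := C0; exists (dotr x (radial_proj y)), x.
move=> _ [x xC <-]; rewrite dotrZr -[leRHS]invrK.
have yV0 : 0 <= (enorm y)^-1 by rewrite invr_ge0 ltW.
rewrite (le_trans (ler_norm _))// normrM (ger0_norm yV0).
rewrite (@le_trans _ _ (enorm y)^-1)//.
  by rewrite ler_piMr//; exact: Py.
by rewrite lef_pV2// posrE invr_gt0.
Qed.

End covering_bounds.

Theorem theorem5p6 (R : realType) (n : nat) (C : {fset 'rV[R]_n}) :
  (2 <= n)%N -> antipodal C -> spherical_design 3 C ->
  1 / Num.sqrt n%:R <= rho C /\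
  rho C <= 1 / n%:R * Num.sqrt (#|` C|%:R / 2).
Proof.
move=> n2 antiC desC; have n_gt0 : (0 < n)%N by exact: leq_trans n2.
have [y y1 yle] := code_height_le n_gt0 antiC desC.
(* This serves both bounds: [inf] lies below the members of a set only when the set is bounded
   below. *)
have lb : lbound [set sup [set dotr x y | x in [set` C]] | y in sphere n]
    (1 / Num.sqrt n%:R).
  by move=> _ [z z1 <-]; exact: code_height_ge.
split; first by apply: lb_le_inf lb; exists (sup [set dotr x y | x in [set` C]]), y.
apply: le_trans yle; apply: ge_inf; last by exists y.
by exists (1 / Num.sqrt n%:R).
Qed.
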